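(* The spatial triangulation method $\mathcal{T}_S$ is affine-invariant: for any two snapshots $A$ and $B$ (each given by a finite set of triangles) for which there is an affinity $\alpha:\mathbb{R}^2\to\mathbb{R}^2$ such that $\alpha(A)=B$ (equality of subsets of $\mathbb{R}^2$), one also has $\alpha(\mathcal{T}_S(A))=\mathcal{T}_S(B)$, i.e. the set of triangles $\{\alpha(T)\mid T\in\mathcal{T}_S(A)\}$ equals the set of triangles $\mathcal{T}_S(B)$.
   Context: Affinity: an invertible affine map of $\mathbb{R}^2$. Triangles. A triangle is a closed filled triangle in $\mathbb{R}^2$, given by its three corner points with rational or real algebraic coordinates; it may degenerate to a closed line segment or a point. Snapshots. A snapshot is a subset $S\subseteq\mathbb{R}^2$ given as a finite union of (possibly overlapping, possibly degenerate) triangles. Standing assumption: $S$ is fully two-dimensional, i.e. $S$ equals the union of the nondegenerate triangles in the given set. The sets of triangles describing $A$ and $B$ need not correspond under $\alpha$; only the unions do. Algorithm $\mathcal{T}_S$. On input $S$ given by a finite set of triangles: (1) Let $\mathcal{B}(S)$ be the set of those edges of the input triangles that contribute to the boundary of $S$, i.e. that contain a nondegenerate segment of the topological boundary of $S$; also compute the planar subdivision $\mathcal{U}(S)$ induced by the input triangles. (2) Compute the convex hull $\mathcal{CH}(S)$ of all corner points of the input triangles. (3) Compute the subdivision of $\mathcal{CH}(S)$ (used as bounding box) induced by all lines through the segments of $\mathcal{B}(S)$; its faces are convex polygons. (4) For each face with vertices $v_1,\ldots,v_c$ in cyclic order, compute $a=\frac1c\sum_{i=1}^c v_i$; if $a$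 belongs to $S$ (i.e. to a face of $\mathcal{U}(S)$ contained in $S$), output the $c$ closed triangles with corner points $a,v_i,v_{i+1}$ ($i=1,\ldots,c$, with $v_{c+1}=v_1$). The output is the set of all triangles so produced, denoted $\mathcal{T}_S(S)$. *)

(* Defs.v *)
(* MathComp / MathComp-Analysis. *)
From HB Require Import structures.
From mathcomp Require Import all_boot all_order all_algebra.
From mathcomp Require Import all_classical all_reals all_analysis.

Set Implicit Arguments.
Unset Strict Implicit.
Unset Printing Implicit Defensive.

Import Order.TTheory GRing.Theory Num.Theory.
Import numFieldNormedType.Exports.

Local Open Scope classical_set_scope.
Local Open Scope ring_scope.

Notation plane R := 'rV[R]_2.

Section PlaneGeometry.
Context {R : realType}.
Implicit Types (p q v x y : plane R) (X F : set (plane R)).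

(* Points are row vectors, hence the matrix acts on the right. *)
Definition affinity (alpha : plane R -> plane R) : Prop :=
  exists (M : 'M[R]_2) (b : plane R),
    M \in unitmx /\ forall x, alpha x = x *m M + b.

Definition convex_hull X : set (plane R) :=
  smallest (@convex_set R (plane R)) X.

Definition segment p q : set (plane R) := convex_hull [set p; q].

Definition line p q : set (plane R) :=
  [set p + t *: (q - p) | t in [set: R]].

Definition boundary X : set (plane R) := closure X `\` X^°.

(* For a convex polygon F these are its corners; points in the relative
   interior of a side are excluded. *)
Definition polygon_vertex F v : Prop :=
  F v /\ forall x y, F x -> F y -> segment x y v -> v = x \/ v = y.

(* [next vs v] is the cyclic successor of [v] in [vs].  In a convex polygon two
   vertices are consecutive exactly when the segment joining them lies on the
   boundary, so [vs] is determined up to rotation and reversal. *)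
Definition cyclic_vertices F (vs : seq (plane R)) : Prop :=
  [/\ uniq vs,
      forall v, v \in vs <-> polygon_vertex F v
    & forall v, v \in vs -> segment v (next vs v) `<=` boundary F].

Definition vertex_mean (vs : seq (plane R)) : plane R :=
  (size vs)%:R^-1 *: \sum_(v <- vs) v.

End PlaneGeometry.

(* Rational numbers are in particular algebraic. *)
Record triangle (R : realType) := Triangle {
  corner : 'I_3 -> plane R;
  corner_algebraic : forall i j, algebraicOver (@ratr R) (corner i ord0 j)
}.

Section Snapshots.
Context {R : realType}.
Implicit Types (T : triangle R) (A : set (triangle R)).

Definition filled T : set (plane R) := convex_hull (range (corner T)).

(* A segment with equal end points is a point. *)
Definition degenerate T : Prop :=
  exists p q : plane R, filled T = segment p q.

Definition covered A : set (plane R) := \bigcup_(T in A) filled T.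

Definition snapshot A : Prop :=
  finite_set A /\ covered A = covered [set T | A T /\ ~ degenerate T].

Definition edges T : set (set (plane R)) :=
  [set e | exists i j : 'I_3, i != j /\ e = segment (corner T i) (corner T j)].

Definition boundary_edges A : set (set (plane R)) :=
  [set e | (exists2 T, A T & edges T e) /\
           exists x y : plane R,
             [/\ x != y, segment x y `<=` e
               & segment x y `<=` boundary (covered A)]].

Definition boundary_lines A : set (set (plane R)) :=
  [set l | exists p q : plane R,
             boundary_edges A (segment p q) /\ l = line p q].

Definition bounding_hull A : set (plane R) :=
  convex_hull (\bigcup_(T in A) range (corner T)).

(* The open faces are the connected components of the complement of the lines
   in the interior of the hull. *)
Definition open_region A : set (plane R) :=
  (bounding_hull A)^° `\` \bigcup_(l in boundary_lines A) l.

Definition faces A : set (set (plane R)) :=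
  [set closure (connected_component (open_region A) x) | x in open_region A].

(* Output triangles are identified with the closed point sets they fill. *)
Definition spatial_triangulation A : set (set (plane R)) :=
  [set T | exists F vs v,
     [/\ faces A F, cyclic_vertices F vs, covered A (vertex_mean vs), v \in vs
       & T = convex_hull [set vertex_mean vs; v; next vs v]]].

End Snapshots.

(* Main.v *)
Require Import Defs.
From HB Require Import structures.
From mathcomp Require Import all_boot all_order all_algebra.
From mathcomp Require Import all_classical all_reals all_analysis.
From mathcomp Require Import ring lra.

(* The triangulation depends only on the point set S of the snapshot, not on
   the triangles that describe it.  The hull of all corners is the hull of S.
   The boundary of S lies in the finitely many edges, so every nondegenerate
   segment in it has two distinct points on one edge, and the lines of the
   algorithm are exactly the lines carrying a nondegenerate segment of the
   boundary of S.  What is built from S (hull, boundary, lines, components,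
   closures, extreme points, means) is preserved by an affinity, which is a
   homeomorphism compatible with convex combinations; applying this to the
   inverse affinity as well turns the inclusion into an equality. *)

Set Implicit Arguments.
Unset Strict Implicit.
Unset Printing Implicit Defensive.

Import Order.TTheory GRing.Theory Num.Theory.
Import numFieldNormedType.Exports.

Local Open Scope classical_set_scope.
Local Open Scope ring_scope.

(** * Preliminaries on infinite sets and images *)

Lemma infinite_two (S : Type) (X : set S) : infinite_set X ->
  exists x y, [/\ X x, X y & x <> y].
Proof.
move=> inf; have [x Xx] := infinite_setN0 inf.
apply: contrapT => none; apply: inf; apply: sub_finite_set (finite_set1 x).
move=> y Xy; apply: contrapT => yx; apply: none; exists x, y; split=> // xy.
exact: yx.
Qed.

Lemma can_image (T U : Type) (f : T -> U) (g : U -> T) (X : set T) :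
  cancel f g -> g @` (f @` X) = X.
Proof.
move=> fK; rewrite image_comp (_ : g \o f = id) ?image_id//.
by apply/funext => x /=; exact: fK.
Qed.

(** * Convex hulls *)

Section Convexity.
Context {R : realType}.
Implicit Types (p q r x y : plane R) (X Y : set (plane R)) (t : R).

Lemma convex_setE X : @convex_set R (plane R) X <->
  forall x y t, X x -> X y -> 0 <= t <= 1 -> X (t *: x + (1 - t) *: y).
Proof.
split=> [cX x y t Xx Xy t01|cX x y l /set_mem Xx /set_mem Xy].
  exact: (set_mem (cX x y (Itv01 (andP t01).1 (andP t01).2)
    (mem_set Xx) (mem_set Xy))).
by apply/mem_set/(cX x y l%:num) => //; rewrite ge0 le1.
Qed.

Lemma convex_convex_hull X : @convex_set R (plane R) (convex_hull X).
Proof.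
apply/convex_setE => x y t Xx Xy t01 Y [cY XY].
by have /convex_setE := cY; apply => //; [exact: Xx|exact: Xy].
Qed.

Lemma sub_convex_hull X : X `<=` convex_hull X.
Proof. exact: sub_gen_smallest. Qed.

Lemma convex_hull_sub X Y :
  X `<=` convex_hull Y -> convex_hull X `<=` convex_hull Y.
Proof. by move=> XY; apply: smallest_sub => //; exact: convex_convex_hull. Qed.

Lemma segmentE p q :
  segment p q = [set t *: p + (1 - t) *: q | t in [set t : R | 0 <= t <= 1]].
Proof.
apply/seteqP; split.
  apply: smallest_sub => [|z [->|->]].
  - apply/convex_setE => _ _ t [a /andP[a0 a1] <-] [b /andP[b0 b1] <-].
    move=> /andP[t0 t1].
    exists (t * a + (1 - t) * b); first by apply/andP; split; nra.
    by apply/rowP => i; rewrite !mxE; ring.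
  - exists 1; first by rewrite /= ler01 lexx.
    by rewrite scale1r subrr scale0r addr0.
  - exists 0; first by rewrite /= ler01 lexx.
    by rewrite subr0 scale1r scale0r add0r.
move=> _ [t t01 <-].
have /convex_setE := @convex_convex_hull [set p; q]; apply => //.
  by apply: sub_convex_hull; left.
by apply: sub_convex_hull; right.
Qed.

Lemma segment_sub_convex X p q :
  @convex_set R (plane R) X -> X p -> X q -> segment p q `<=` X.
Proof. by move=> cX Xp Xq; apply: smallest_sub => // z [->|->]. Qed.

Lemma segment_left p q : segment p q p.
Proof. by apply: sub_convex_hull; left. Qed.

Lemma segment_right p q : segment p q q.
Proof. by apply: sub_convex_hull; right. Qed.

Lemma segment_sub_line p q : segment p q `<=` line p q.
Proof.
rewrite segmentE => _ [t _ <-]; exists (1 - t) => //.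
by apply/rowP => i; rewrite !mxE; ring.
Qed.

Lemma line_eq p q x y :
  x != y -> line p q x -> line p q y -> line x y = line p q.
Proof.
move=> + [s _ sx] [t _ ty]; rewrite -{}sx -{}ty.
have [->|st _] := eqVneq s t; first by rewrite eqxx.
have st0 : t - s != 0 by rewrite subr_eq0 eq_sym.
apply/seteqP; split=> _ [u _ <-].
  exists (s + u * (t - s)) => //.
  by apply/rowP => i; rewrite !mxE; ring.
(* Parameters on the two lines are related by [u = s + u' * (t - s)]; this is the solution for
   [u']. *)
exists ((u - s) / (t - s)) => //.
by apply/rowP => i; rewrite !mxE; field.
Qed.

Lemma infinite_segment p q : p != q -> infinite_set (segment p q).
Proof.
(* The weights [1 / (n + 1)] are pairwise distinct and lie in the unit interval, so they give an
   injective sequence of points of the segment. *)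
move=> pq; pose f (n : nat) := n.+1%:R^-1 *: p + (1 - n.+1%:R^-1) *: q.
suff /(@inj_card_eq _ _ setT)/eq_finite_set fE : {in setT &, injective f}.
  move=> fin; apply: infinite_nat; rewrite -fE; apply: sub_finite_set fin.
  move=> _ [n _ <-]; rewrite segmentE; exists n.+1%:R^-1 => //=.
  by rewrite invr_ge0 ler0n invf_le1 ?ltr0n// ler1n.
move=> m n _ _ /eqP; rewrite -subr_eq0 /f.
have -> : m.+1%:R^-1 *: p + (1 - m.+1%:R^-1) *: q -
    (n.+1%:R^-1 *: p + (1 - n.+1%:R^-1) *: q) =
    (m.+1%:R^-1 - n.+1%:R^-1) *: (p - q).
  by apply/rowP => i; rewrite !mxE; ring.
rewrite scaler_eq0 [X in _ || X]subr_eq0 (negbTE pq) orbF subr_eq0 => /eqP.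
by move/invr_inj/eqP; rewrite eqr_nat => /eqP[].
Qed.

End Convexity.

(** * The hull of three points: convex weights and closedness *)

Section TriangleHull.
Context {R : realType}.
Variable c : 'I_3 -> plane R.

Let one : 'I_3 := lift ord0 ord0.
Let two : 'I_3 := lift ord0 (lift ord0 ord0).

Let sum3 (V : zmodType) (F : 'I_3 -> V) : \sum_i F i = F ord0 + (F one + F two).
Proof. by rewrite !big_ord_recl big_ord0 addr0. Qed.

Let ord3P (P : 'I_3 -> Prop) : P ord0 -> P one -> P two -> forall i, P i.
Proof.
move=> P0 P1 P2 i; case: (unliftP ord0 i) => [j|] ->//.
case: (unliftP ord0 j) => [k|] ->//.
by rewrite (_ : k = ord0) //; apply/val_inj; case: k => -[].
Qed.

Definition convex_combinations : set (plane R) :=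
  [set \sum_i w i *: c i |
    w in [set w : 'I_3 -> R | (forall i, 0 <= w i) /\ \sum_i w i = 1]].

(** The triangle as a cone with apex [c ord0] over the opposite side. Being continuous on the
    compact unit square, this parametrization makes the triangle compact, hence closed, even when
    the corners are collinear. *)
Definition cone_map (u : R * R) : plane R :=
  u.1 *: c ord0 + (1 - u.1) *: (u.2 *: c one + (1 - u.2) *: c two).

Definition unit_square : set (R * R) := `[0, 1] `*` `[0, 1].

Lemma convex_hull_range_sub : convex_hull (range c) `<=` convex_combinations.
Proof.
apply: smallest_sub => [|_ [i _ <-]].
  apply/convex_setE => _ _ t [w [w0 w1] <-] [v [v0 v1] <-] /andP[t0 t1].
  exists (fun i => t * w i + (1 - t) * v i); last first.
    rewrite !sum3 !scalerDr !scalerDl !scalerA.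
    by apply/rowP => i; rewrite !mxE; ring.
  split=> [i|]; first by have := w0 i; have := v0 i; nra.
  by rewrite big_split/= -!mulr_sumr w1 v1; ring.
exists (fun j => (j == i)%:R).
  split=> [j|]; first by case: (j == i).
  by rewrite (bigD1 i)//= eqxx big1 ?addr0// => j /negbTE ->.
rewrite (bigD1 i)//= eqxx scale1r big1 ?addr0// => j /negbTE ->.
by rewrite scale0r.
Qed.

Lemma convex_combinations_sub :
  convex_combinations `<=` cone_map @` unit_square.
Proof.
move=> _ [w [w0 w1] <-]; move: w1; rewrite !sum3.
have := w0 ord0; have := w0 one; have := w0 two.
set a := w ord0; set b := w one; set d := w two => d0 b0 a0 abd.
(* At the apex the remaining weight [1 - a] is zero and cannot be divided by; there the second
   parameter is arbitrary. *)
have [a1|a1] := eqVneq a 1.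
  exists (1, 1); first by split; rewrite /= in_itv/= ler01 lexx.
  have -> : b = 0 by lra.
  have -> : d = 0 by lra.
  by rewrite a1 /cone_map/= !subrr !scale0r !addr0.
have a1' : 0 < 1 - a by rewrite subr_gt0 lt_neqAle a1; lra.
(* The second parameter is the share of [c one] in the weight left over by the apex. *)
exists (a, b / (1 - a)).
  split; rewrite /= in_itv/=; first by apply/andP; split; lra.
  by rewrite divr_ge0 ?(ltW a1')//= ler_pdivrMr// mul1r; lra.
have -> : d = 1 - a - b by lra.
by apply/rowP => i; rewrite !mxE /=; field; rewrite gt_eqF.
Qed.

Lemma cone_map_sub : cone_map @` unit_square `<=` convex_hull (range c).
Proof.
move=> _ [[s t] [/= + +] <-]; rewrite !in_itv/= => s01 t01.
have cH := @convex_convex_hull R (range c).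
have Hc i : convex_hull (range c) (c i) by apply: sub_convex_hull; exists i.
move/convex_setE : (cH) => cH'.
by apply: (cH' _ _ _ _ _ s01); [exact: Hc|exact: cH'].
Qed.

Lemma convex_hull_rangeE : convex_hull (range c) = convex_combinations.
Proof.
apply/seteqP; split; first exact: convex_hull_range_sub.
by apply: subset_trans cone_map_sub; exact: convex_combinations_sub.
Qed.

Lemma cone_map_continuous : continuous cone_map.
Proof.
move=> u; rewrite /cone_map.
have fst1 : {for u, continuous (fun u : R * R => u.1)} by exact: cvg_fst.
have snd1 : {for u, continuous (fun u : R * R => u.2)} by exact: cvg_snd.
apply: cvgD; first exact: cvgZr_tmp.
apply: cvgZ; first by apply: cvgB => //; exact: cvg_cst.
apply: cvgD; first exact: cvgZr_tmp.
by apply: cvgZr_tmp; apply: cvgB => //; exact: cvg_cst.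
Qed.

Lemma closed_convex_hull_range : closed (convex_hull (range c)).
Proof.
have -> : convex_hull (range c) = cone_map @` unit_square.
  apply/seteqP; split; last exact: cone_map_sub.
  by rewrite convex_hull_rangeE; exact: convex_combinations_sub.
apply: compact_closed; first exact: norm_hausdorff.
apply: continuous_compact.
  exact/continuous_subspaceT/cone_map_continuous.
by apply: compact_setX; exact: segment_compact.
Qed.

(* Moving along a vanishing combination [l] with zero total weight, the first
   weight to vanish is one with [l i < 0]. *)
Lemma dependent_vanishing_weight (w l : 'I_3 -> R) :
  (forall i, 0 <= w i) -> \sum_i l i = 0 -> (exists i, l i != 0) ->
  exists t, (forall i, 0 <= w i + t * l i) /\ exists i, w i + t * l i = 0.
Proof.
move=> w0 l0 [k lk].
have [i0 li0] : exists i, l i < 0.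
  apply: contrapT => /forallNP ln.
  have lp i : 0 <= l i by rewrite leNgt; exact/negP.
  move/eqP: l0; rewrite psumr_eq0// => /allP/(_ k).
  by rewrite mem_index_enum (negbTE lk) => /(_ isT).
pose m := [arg min_(i < i0 | l i < 0) (w i / - l i)]%O.
have [lm mP] : l m < 0 /\ forall j, l j < 0 -> w m / - l m <= w j / - l j.
  by rewrite /m; case: Order.TotalTheory.arg_minP.
exists (w m / - l m); split; last first.
  by exists m; rewrite invrN mulrN mulNr divfK ?lt_eqF// subrr.
move=> j; have [lj|lj] := ltP (l j) 0.
  have := mP j lj; rewrite ler_pdivlMr ?oppr_gt0//; lra.
by rewrite addr_ge0// mulr_ge0// divr_ge0// oppr_ge0 ltW.
Qed.

(** Once a weight is zero, only the other two corners contribute, and their weights still sum to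
    1. *)
Lemma vanishing_weight_segment (w : 'I_3 -> R) :
  (forall i, 0 <= w i) -> \sum_i w i = 1 -> (exists i, w i = 0) ->
  exists i j, i != j /\ segment (c i) (c j) (\sum_i w i *: c i).
Proof.
move=> w0 + [i]; rewrite !sum3 => + wi.
have := w0 ord0; have := w0 one; have := w0 two.
move: i wi; apply: ord3P => ->; rewrite scale0r ?addr0 ?add0r => w2 w1 w0' s1.
- exists one, two; split=> //; rewrite segmentE; exists (w one).
    by apply/andP; split; lra.
  by congr (_ + _ *: _); lra.
- exists ord0, two; split=> //; rewrite segmentE; exists (w ord0).
    by apply/andP; split; lra.
  by congr (_ + _ *: _); lra.
- exists ord0, one; split=> //; rewrite segmentE; exists (w ord0).
    by apply/andP; split; lra.
  by congr (_ + _ *: _); lra.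
Qed.

End TriangleHull.

(** * The boundary of a triangle *)

Section TriangleBoundary.
Context {R : realType}.

Lemma affine_continuous (M : 'M[R]_2) (b : plane R) :
  continuous (fun x : plane R => x *m M + b).
Proof.
(* As a sum of coordinates times fixed rows, the map inherits continuity from the coordinate
   functions. *)
have -> : (fun x : plane R => x *m M + b) =
    (fun x : plane R => (\sum_i x ord0 i *: row i M) + b).
  by apply/funext => x; rewrite mulmx_sum_row.
move=> x; apply: (@cvgD _ _ _ (nbhs x)); last exact: cvg_cst.
apply: cvg_big => [|i _]; first exact: add_continuous.
by apply: cvgZr_tmp; exact: coord_continuous.
Qed.

Variable c : 'I_3 -> plane R.

(* Relative to the corner [c ord0]: with these sides as rows, a point
   [c ord0 + u *m side_mx] has barycentric coordinates [side_weights u]. *)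
Definition side_mx : 'M[R]_2 := \matrix_(j < 2) (c (lift ord0 j) - c ord0).

Lemma combination_side_mx (w : 'I_3 -> R) :
  \sum_i w i *: c i =
  (\sum_i w i) *: c ord0 + (\row_j w (lift ord0 j)) *m side_mx.
Proof.
rewrite mulmx_sum_row !big_ord_recl !big_ord0 !mxE !rowK.
by apply/rowP => i; rewrite !mxE; ring.
Qed.

Definition side_weights (u : plane R) (i : 'I_3) : R :=
  if unlift ord0 i is Some j then u ord0 j else 1 - \sum_j u ord0 j.

Lemma side_weights_lift u j : side_weights u (lift ord0 j) = u ord0 j.
Proof. by rewrite /side_weights liftK. Qed.

Lemma side_weights0 u : side_weights u ord0 = 1 - \sum_j u ord0 j.
Proof. by rewrite /side_weights unlift_none. Qed.

Lemma sum_side_weights u : \sum_i side_weights u i = 1.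
Proof.
rewrite big_ord_recl side_weights0.
by rewrite (eq_bigr _ (fun j _ => side_weights_lift u j)) subrK.
Qed.

(** When the sides are independent, barycentric coordinates are continuous functions on the whole
    plane. Positive at the given point, they stay positive nearby, so all nearby points are convex
    combinations of the corners. *)
Lemma interior_convex_hull_range (w : 'I_3 -> R) :
  side_mx \in unitmx -> (forall i, 0 < w i) -> \sum_i w i = 1 ->
  (convex_hull (range c))° (\sum_i w i *: c i).
Proof.
move=> uM w0 w1; set x := \sum_i _.
pose coord (y : plane R) := y *m invmx side_mx - c ord0 *m invmx side_mx.
have coordK y : c ord0 + coord y *m side_mx = y.
  by rewrite /coord mulmxBl !mulmxKV// subrKC.
have coord_x : coord x = \row_j w (lift ord0 j).
  rewrite /coord /x combination_side_mx w1 scale1r mulmxDl mulmxK//.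
  by rewrite addrAC subrr add0r.
have coord_cont : continuous coord by exact: affine_continuous.
have weight_cont i : continuous (fun y => side_weights (coord y) i).
  move=> y; rewrite /side_weights; case: (unlift ord0 i) => [j|].
    apply: (@continuous_comp _ _ _ coord (fun u : plane R => u ord0 j)).
      exact: coord_cont.
    exact: coord_continuous.
  apply: (@cvgB _ _ _ (nbhs y)); first exact: cvg_cst.
  apply: cvg_big => [|j _]; first exact: add_continuous.
  apply: (@continuous_comp _ _ _ coord (fun u : plane R => u ord0 j)).
    exact: coord_cont.
  exact: coord_continuous.
have weight_x i : 0 < side_weights (coord x) i.
  rewrite coord_x; case: (unliftP ord0 i) => [j|] ->.
    by rewrite side_weights_lift mxE.
  rewrite side_weights0; have := w0 ord0.
  rewrite -w1 [in X in _ -> 0 < X - _]big_ord_recl.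
  by under [X in _ -> 0 < _ - X]eq_bigr do rewrite mxE; rewrite addrK.
have near_x i : \forall y \near nbhs x, 0 < side_weights (coord y) i.
  exact: (weight_cont i x _ (lt_nbhsr (weight_x i))).
have nbhsF : Filter (nbhs (x : plane R)) := nbhs_filter _.
apply: (filterS _ (filter_forall nbhsF near_x)) => y y0; rewrite convex_hull_rangeE.
exists (side_weights (coord y)).
  by split=> [i|]; [exact/ltW|exact: sum_side_weights].
rewrite combination_side_mx sum_side_weights scale1r -[RHS]coordK.
by congr (_ + _ *m _); apply/rowP => j; rewrite mxE side_weights_lift.
Qed.

(** If all weights are positive, a noninterior point forces the sides to be dependent. A dependency
    then lets the weights vary without moving the point until one of them vanishes, which places the
    point on an edge. *)
Lemma convex_hull_range_boundary x :
  convex_hull (range c) x -> ~ (convex_hull (range c))° x ->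
  exists i j, i != j /\ segment (c i) (c j) x.
Proof.
rewrite [in X in X -> _]convex_hull_rangeE => -[w [w0 w1] <-] nint.
have [w_eq0|w_neq0] := pselect (exists i, w i = 0).
  exact: vanishing_weight_segment.
have wgt0 i : 0 < w i.
  by rewrite lt_neqAle w0 andbT eq_sym; apply/eqP => wi; apply: w_neq0; exists i.
have /negP : ~ side_mx \in unitmx.
  by move=> uM; apply: nint; exact: interior_convex_hull_range.
rewrite unitmxE unitfE negbK => /det0P[v v0 vM].
(* The change of weights along the kernel vector [v]: its total is zero, and it leaves the point
   fixed because [v *m side_mx c = 0]. *)
pose l i := side_weights v i - side_weights 0 i.
have suml : \sum_i l i = 0 by rewrite sumrB !sum_side_weights subrr.
have [j vj] : exists j, v ord0 j != 0.
  apply: contrapT => /forallNP vn; case/eqP: v0; apply/rowP => j.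
  by rewrite mxE; apply/eqP; rewrite -[_ == _]negbK; exact/negP.
have [|t [wt0 wt]] := dependent_vanishing_weight w0 suml.
  by exists (lift ord0 j); rewrite /l !side_weights_lift mxE subr0.
have wt1 : \sum_i (w i + t * l i) = 1.
  by rewrite big_split/= -mulr_sumr suml mulr0 addr0.
rewrite (_ : \sum_i _ = \sum_i (w i + t * l i) *: c i).
  exact: vanishing_weight_segment.
rewrite !combination_side_mx w1 wt1; congr (_ + _).
rewrite (_ : \row_j (w (lift ord0 j) + _) = \row_j w (lift ord0 j) + t *: v).
  by rewrite mulmxDl -scalemxAl vM scaler0 addr0.
by apply/rowP => k; rewrite !mxE /l !side_weights_lift !mxE subr0.
Qed.

End TriangleBoundary.

(** * Affinities *)

Section AffinityImages.
Context {R : realType}.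
Implicit Types (alpha : plane R -> plane R) (X F O : set (plane R)).
Implicit Types (p q v x y : plane R).

Lemma affinity_continuous alpha : affinity alpha -> continuous alpha.
Proof.
by move=> [M [b [_ /funext ->]]]; exact: affine_continuous.
Qed.

Lemma affinity_conv alpha x y (t : R) : affinity alpha ->
  alpha (t *: x + (1 - t) *: y) = t *: alpha x + (1 - t) *: alpha y.
Proof.
move=> [M [b [_ alphaE]]]; rewrite !alphaE mulmxDl -!scalemxAl.
by apply/rowP => i; rewrite !mxE; ring.
Qed.

Lemma affinity_inverse alpha : affinity alpha ->
  exists2 beta, affinity beta & cancel alpha beta /\ cancel beta alpha.
Proof.
move=> [M [b [uM alphaE]]].
exists (fun x => x *m invmx M - b *m invmx M).
  by exists (invmx M), (- (b *m invmx M)); rewrite unitmx_inv.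
split=> x; rewrite alphaE.
  by rewrite mulmxDl mulmxK// addrK.
by rewrite mulmxBl !mulmxKV// subrK.
Qed.

Lemma affinity_inj alpha : affinity alpha -> injective alpha.
Proof. by move=> /affinity_inverse[beta _ [alphaK _]]; exact: can_inj alphaK. Qed.

(* An inclusion natural in all affinities is an equality, by applying it to
   the inverse affinity. *)
Lemma affinity_image_eq (Phi : set (plane R) -> set (plane R)) :
  (forall alpha X, affinity alpha -> alpha @` Phi X `<=` Phi (alpha @` X)) ->
  forall alpha X, affinity alpha -> alpha @` Phi X = Phi (alpha @` X).
Proof.
move=> sub alpha X aff; apply/seteqP; split; first exact: sub.
move=> y Py; have [beta affb [alphaK betaK]] := affinity_inverse aff.
exists (beta y); last exact: betaK.
by rewrite -(can_image X alphaK); apply: sub => //; exists y.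
Qed.

(** The preimage of a convex set under an affine map is convex, so minimality of the hull gives the
    natural inclusion. *)
Lemma image_convex_hull alpha X : affinity alpha ->
  alpha @` convex_hull X = convex_hull (alpha @` X).
Proof.
move: alpha X; apply: affinity_image_eq => alpha X aff.
apply/image_subP; apply: smallest_sub => [|x Xx]; last first.
  by apply: sub_convex_hull; exists x.
apply/convex_setE => x y t Hx Hy t01 /=; rewrite affinity_conv//.
by have /convex_setE := @convex_convex_hull R (alpha @` X); apply.
Qed.

Lemma image_segment alpha p q : affinity alpha ->
  alpha @` segment p q = segment (alpha p) (alpha q).
Proof. by move=> aff; rewrite /segment image_convex_hull// image_setU !image_set1. Qed.

Lemma image_line alpha p q : affinity alpha ->
  alpha @` line p q = line (alpha p) (alpha q).
Proof.
move=> aff; rewrite /line image_comp; apply: eq_imagel => t _ /=.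
have conv x y : x + t *: (y - x) = t *: y + (1 - t) *: x.
  by apply/rowP => i; rewrite !mxE; ring.
by rewrite !conv affinity_conv.
Qed.

Lemma image_closure alpha X : affinity alpha ->
  alpha @` closure X = closure (alpha @` X).
Proof.
move: alpha X; apply: affinity_image_eq => alpha X aff.
apply/image_subP; rewrite [closure X]closureE; apply: smallest_sub.
  apply: preimage_closed; last exact: closed_closure.
  by move=> x _; exact: affinity_continuous.
by move=> x Xx; apply: subset_closure; exists x.
Qed.

Lemma image_interior alpha X : affinity alpha ->
  alpha @` X° = (alpha @` X)°.
Proof.
move: alpha X; apply: affinity_image_eq => alpha X aff _ [x Xx <-].
have [beta affb [alphaK betaK]] := affinity_inverse aff.
(* Images are preimages under the inverse, whose continuity carries neighbourhoods over. *)
have : nbhs (alpha x) (beta @^-1` X).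
  by apply: (affinity_continuous affb); rewrite alphaK.
by apply: filterS => y Xy; exists (beta y).
Qed.

Lemma image_boundary alpha X : affinity alpha ->
  alpha @` boundary X = boundary (alpha @` X).
Proof.
move=> aff; rewrite /boundary -image_closure// -image_interior//.
apply/seteqP; split=> [_ [x [cx nx] <-]|_ [[x cx <-] nx]].
  split; first by exists x.
  by move=> [y iy /(affinity_inj aff) yx]; rewrite yx in iy.
by exists x => //; split=> // ix; apply: nx; exists x.
Qed.

(** The image of a component is connected and contains the image of the base point. Since the base
    point moves too, the inverse affinity is applied by hand instead of through
    [affinity_image_eq]. *)
Lemma image_connected_component alpha O x : affinity alpha -> O x ->
  alpha @` connected_component O x = connected_component (alpha @` O) (alpha x).
Proof.
have sub beta Q y : affinity beta -> Q y ->
  beta @` connected_component Q y `<=`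
  connected_component (beta @` Q) (beta y).
  move=> aff Qy; apply: connected_component_max.
  - by exists y => //; exact: connected_component_refl.
  - by apply: image_subset; exact: connected_component_sub.
  - apply: connected_continuous_connected; first exact: component_connected.
    exact/continuous_subspaceT/affinity_continuous.
move=> aff Ox; apply/seteqP; split; first exact: sub.
move=> y Cy; have [beta affb [alphaK betaK]] := affinity_inverse aff.
exists (beta y); last exact: betaK.
rewrite -(can_image O alphaK) -(alphaK x); exact: (sub beta).
Qed.

Lemma image_polygon_vertex alpha F v : affinity alpha ->
  polygon_vertex F v -> polygon_vertex (alpha @` F) (alpha v).
Proof.
move=> aff [Fv ext]; split; first by exists v.
move=> _ _ [x Fx <-] [y Fy <-]; rewrite -image_segment// => -[z xyz].
move=> /(affinity_inj aff) zv; rewrite zv in xyz.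
by have [->|->] := ext x y Fx Fy xyz; [left|right].
Qed.

Lemma image_cyclic_vertices alpha F vs : affinity alpha ->
  cyclic_vertices F vs -> cyclic_vertices (alpha @` F) (map alpha vs).
Proof.
move=> aff [uvs vsF bd]; have inj := affinity_inj aff.
have [beta affb [alphaK betaK]] := affinity_inverse aff.
split; first by rewrite map_inj_uniq.
- move=> v; split=> [/mapP[x /vsF Fx ->]|Fv].
    exact: image_polygon_vertex.
  (* A vertex of the image is pulled back by [beta] to a vertex of [F]. *)
  rewrite -[v]betaK mem_map//; apply/vsF.
  by rewrite -(can_image F alphaK); exact: image_polygon_vertex.
- move=> _ /mapP[v vvs ->]; rewrite next_map// -image_segment// -image_boundary//.
  by apply: image_subset; exact: bd.
Qed.

(** The coefficients of the mean sum to 1, so the translation survives exactly once. For the empty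
    list they sum to 0 and the mean is 0, whatever the translation. *)
Lemma affinity_vertex_mean alpha (vs : seq (plane R)) : affinity alpha ->
  vs != [::] -> alpha (vertex_mean vs) = vertex_mean (map alpha vs).
Proof.
move=> [M [b [_ alphaE]]] vs0; rewrite /vertex_mean size_map big_map alphaE.
under eq_bigr do rewrite alphaE.
rewrite big_split/= -mulmx_suml big_const_seq count_predT iter_addr addr0.
rewrite scalerDr scalemxAl -[b *+ _]scaler_nat scalerA mulVf ?scale1r//.
by rewrite pnatr_eq0 size_eq0.
Qed.

End AffinityImages.

(** * Snapshots *)

Section SnapshotGeometry.
Context {R : realType}.
Implicit Types (T : triangle R) (A B : set (triangle R)).

Lemma finite_edges T : finite_set (edges T).
Proof.
apply: (@sub_finite_set _ _
  ((fun u : 'I_3 * 'I_3 => segment (corner T u.1) (corner T u.2)) @` setT)).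
  by move=> _ [i [j [_ ->]]]; exists (i, j).
exact/finite_image/finite_finset.
Qed.

Lemma closed_covered A : finite_set A -> closed (covered A).
Proof.
move=> finA; rewrite (_ : covered A = \bigcup_(X in filled @` A) X).
  apply: closed_bigcup; first exact: finite_image.
  by move=> _ [T _ <-]; exact: closed_convex_hull_range.
by rewrite bigcup_image.
Qed.

(** The union is closed, so a boundary point lies in some triangle; it is not interior to that
    triangle, as it would then be interior to the union. Hence it lies on one of its edges. *)
Lemma boundary_covered_sub_edges A : finite_set A ->
  boundary (covered A) `<=` \bigcup_(e in \bigcup_(T in A) edges T) e.
Proof.
move=> finA x [+ nint]; rewrite -(closure_id _).1; last exact: closed_covered.
move=> [T AT Tx].
have [||i [j [ij xij]]] := @convex_hull_range_boundary R (corner T) x.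
- exact: Tx.
- by move=> intx; apply: nint; apply: interiorS intx => y Ty; exists T.
by exists (segment (corner T i) (corner T j)) => //; exists T => //; exists i, j.
Qed.

(* A segment in the boundary is covered by the finitely many edges, so one of
   them meets it in two distinct points. *)
Lemma boundary_linesE A : finite_set A ->
  boundary_lines A = [set l | exists x y, [/\ x != y,
    segment x y `<=` boundary (covered A) & l = line x y]].
Proof.
move=> finA; apply/seteqP; split=> l [p [q]].
  move=> [[_ [x [y [xy xy_pq xy_bd]]]] ->]; exists x, y; split=> //.
  apply/esym/line_eq => //; apply: segment_sub_line; apply: xy_pq.
    exact: segment_left.
  exact: segment_right.
move=> [pq pq_bd ->].
pose E := \bigcup_(T in A) edges T.
have finE : finite_set E by apply: bigcup_finite => // T _; exact: finite_edges.
(* Finitely many finite intersections could not cover an infinite segment. *)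
have [e Ee /infinite_two[x [y [[ex sx] [ey sy] /eqP xy]]]] :
    exists2 e, E e & infinite_set (e `&` segment p q).
  apply: contrapT => none; apply: (infinite_segment pq).
  apply: (@sub_finite_set _ _ (\bigcup_(e in E) (e `&` segment p q))).
    move=> z pqz; have [e Ee ez] := boundary_covered_sub_edges finA (pq_bd _ pqz).
    by exists e.
  apply: bigcup_finite => // e Ee; apply: contrapT => inf.
  by apply: none; exists e.
have [T AT [i [j [ij eE]]]] := Ee.
exists (corner T i), (corner T j); rewrite -eE; split.
  split; first by exists T => //; exists i, j.
  (* By convexity, the segment from [x] to [y] lies both in the edge and in the given boundary
     segment, so the edge contributes to the boundary. *)
  exists x, y; split=> //.
    rewrite eE in ex ey *.
    by apply: segment_sub_convex => //; exact: convex_convex_hull.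
  apply: subset_trans pq_bd.
  by apply: segment_sub_convex => //; exact: convex_convex_hull.
rewrite eE in ex ey.
by rewrite -(line_eq xy (segment_sub_line sx) (segment_sub_line sy));
  apply: line_eq => //; exact: segment_sub_line.
Qed.

Lemma bounding_hullE A : bounding_hull A = convex_hull (covered A).
Proof.
apply/seteqP; split; apply: convex_hull_sub.
  move=> x [T AT Tx]; apply: sub_convex_hull; exists T => //.
  exact: sub_convex_hull.
move=> x [T AT]; apply: convex_hull_sub => y Ty; apply: sub_convex_hull.
by exists T.
Qed.

Lemma image_bounding_hull A B (alpha : plane R -> plane R) :
  affinity alpha -> alpha @` covered A = covered B ->
  alpha @` bounding_hull A = bounding_hull B.
Proof. by move=> aff AB; rewrite !bounding_hullE image_convex_hull// AB. Qed.

(** The edges of [A] and [B] need not correspond, but by [boundary_linesE] the lines are determined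
    by boundary segments of the covered sets, and these do correspond. *)
Lemma image_boundary_line A B (alpha : plane R -> plane R) l :
  finite_set A -> finite_set B -> affinity alpha ->
  alpha @` covered A = covered B ->
  boundary_lines A l -> boundary_lines B (alpha @` l).
Proof.
move=> finA finB aff AB; rewrite !boundary_linesE// => -[x [y [xy xy_bd ->]]].
exists (alpha x), (alpha y).
split; last exact: image_line.
  by apply: contra_neq xy; exact: affinity_inj.
by rewrite -AB -image_segment// -image_boundary//; exact: image_subset.
Qed.

End SnapshotGeometry.

(** * Transport of regions, faces and output triangles along an affinity *)

Section TriangulationImage.
Context {R : realType}.
Variables (A B : set (triangle R)) (alpha beta : plane R -> plane R).
Hypotheses (finA : finite_set A) (finB : finite_set B).
Hypotheses (affa : affinity alpha) (affb : affinity beta).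
Hypotheses (alphaK : cancel alpha beta) (betaK : cancel beta alpha).
Hypothesis AB : alpha @` covered A = covered B.

Let BA : beta @` covered B = covered A.
Proof. by rewrite -AB can_image. Qed.

Lemma image_open_region : alpha @` open_region A = open_region B.
Proof.
apply/seteqP; split=> [_ [x [hx nx] <-]|y [hy ny]].
  split; first by rewrite -(image_bounding_hull affa AB) -image_interior//; exists x.
  (* A line of [B] through the image point would pull back to a line of [A] through the original
     point. *)
  move=> [l Bl lx]; apply: nx; exists (beta @` l).
    exact: image_boundary_line BA Bl.
  by exists (alpha x).
exists (beta y) => //; split.
  by rewrite -(image_bounding_hull affb BA) -image_interior//; exists y.
move=> [l Al ly]; apply: ny; exists (alpha @` l).
  exact: image_boundary_line AB Al.
by exists (beta y).
Qed.

Lemma image_faces F : faces A F -> faces B (alpha @` F).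
Proof.
move=> [x Ax <-]; exists (alpha x); first by rewrite -image_open_region; exists x.
by rewrite -image_open_region -image_connected_component// image_closure.
Qed.

Lemma image_spatial_triangulation T :
  spatial_triangulation A T -> spatial_triangulation B (alpha @` T).
Proof.
move=> [F [vs [v [AF Fvs Am vvs ->]]]].
(* The chosen vertex [v] witnesses that the mean is taken over a nonempty list. *)
have vs0 : vs != [::] by case: (vs) vvs.
exists (alpha @` F), (map alpha vs), (alpha v).
rewrite -affinity_vertex_mean// (next_map (affinity_inj affa)); last by case: Fvs.
rewrite image_convex_hull// !image_setU !image_set1; split=> //.
- exact: image_faces.
- exact: image_cyclic_vertices.
- by rewrite -AB; exists (vertex_mean vs).
- exact: map_f.
Qed.

End TriangulationImage.

Theorem mainTheorem4 (R : realType) (A B : set (triangle R))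
    (hA : snapshot A) (hB : snapshot B)
    (alpha : plane R -> plane R) (halpha : affinity alpha)
    (hAB : alpha @` covered A = covered B) :
  [set alpha @` T | T in spatial_triangulation A] = spatial_triangulation B.
Proof.
have [[finA _] [finB _]] := (hA, hB).
have [beta affb [alphaK betaK]] := affinity_inverse halpha.
have hBA : beta @` covered B = covered A by rewrite -hAB can_image.
apply/seteqP; split=> [_ [T AT <-]|T BT].
  exact: (image_spatial_triangulation finA finB halpha affb alphaK betaK hAB).
exists (beta @` T); last by rewrite can_image.
exact: (image_spatial_triangulation finB finA affb halpha betaK alphaK hBA).
Qed.
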